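(* Let $\mathbf E=(E,\mathcal E)$ be a binary relational system which is involutive, reflexive, and has a compact and normal structure. Then every commuting family $\mathcal F$ of endomorphisms of $\mathbf E$ (i.e. $f\circ g=g\circ f$ for all $f,g\in\mathcal F$) has a common fixed point. Furthermore, the restriction of $\mathbf E$ to the set $Fix(\mathcal F)$ of common fixed points of $\mathcal F$ is a one-local retract of $\mathbf E$.
   Context: A binary relational system is a pair $\mathbf E=(E,\mathcal E)$ where $E$ is a set and $\mathcal E$ is a set of binary relations on $E$ (subsets of $E\times E$). For a relation $r$, $r^{-1}=\{(x,y):(y,x)\in r\}$. $\mathbf E$ is reflexive if every $r\in\mathcal E$ contains $\{(x,x):x\in E\}$; it is involutive if for every $r$, $r\in\mathcal E$ iff $r^{-1}\in\mathcal E$. An endomorphism of $\mathbf E$ is a map $f:E\to E$ such that $(x,y)\in r$ implies $(f(x),f(y))\in r$ for all $r\in\mathcal E$. For $x\in E$, $r\in\mathcal E$, the ball of center $x$ and radius $r$ is $B(x,r)=\{y\in E:(x,y)\in r\}$. $\hat{\mathcal B}_{\mathbf E}$ is the set of all intersections of families of balls $B(x,r)$ with $x\in E$, $r\in\mathcal E$ (the empty family gives $E$). For $A\subseteq E$, the diameter is $\delta_{\mathbf E}(A)=\{r\in\mathcal E:A\times A\subseteq r\}$ and the radius is $r_{\mathbf E}(A)=\{r\in\mathcal E:A\subseteq B(x,r)\text{ for some }x\in A\}$. $A$ is equally centered if $r_{\mathbf E}(A)=\delta_{\mathbf E}(A)$. $\mathbf E$ has a normal structure if no $A\in\hat{\mathcal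 B}_{\mathbf E}$ distinct from a singleton is equally centered. $\mathbf E$ has a compact structure if every family of balls (with radii in $\mathcal E$) all of whose finite subfamilies have nonempty intersection has nonempty intersection. For $A\subseteq E$ the restriction of $\mathbf E$ to $A$ is $\mathbf E_{\restriction A}=(A,\{r\cap(A\times A):r\in\mathcal E\})$. A retraction of a system is an endomorphism $g$ with $g\circ g=g$; the restriction to its image is called a retract of the system. $\mathbf E_{\restriction A}$ is a one-local retract of $\mathbf E$ if for every $x\in E$, $\mathbf E_{\restriction A}$ is a retract of $\mathbf E_{\restriction A\cup\{x\}}$. *)

(* Defs.v *)
From mathcomp Require Import all_boot boolp classical_sets cardinality.
Set Implicit Arguments.
Unset Strict Implicit.
Unset Printing Implicit Defensive.
Local Open Scope classical_set_scope.

Record binary_relational_system := BinaryRelationalSystem {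
  carrier :> Type;
  relations : set (set (carrier * carrier)) }.
Arguments relations E : clear implicits, rename.

Definition reflexive_system (E : binary_relational_system) :=
  forall r, relations E r -> diagonal `<=` r.

Definition involutive_system (E : binary_relational_system) :=
  forall r, relations E r <-> relations E (r^-1)%relation.

Definition endomorphism (E : binary_relational_system) (f : E -> E) :=
  forall r, relations E r -> forall x y, r (x, y) -> r (f x, f y).

Definition rball (E : binary_relational_system) (x : E) (r : set (E * E)) : set E :=
  [set y | r (x, y)].

Definition balls (E : binary_relational_system) : set (set E) :=
  [set B | exists x r, relations E r /\ B = rball x r].
Arguments balls E : clear implicits.

(* The empty family is allowed; its intersection is [setT]. *)
Definition ball_intersections (E : binary_relational_system) : set (set E) :=
  [set A | exists2 G, G `<=` balls E & A = \bigcap_(B in G) B].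
Arguments ball_intersections E : clear implicits.

Definition diameter (E : binary_relational_system) (A : set E) : set (set (E * E)) :=
  [set r | relations E r /\ A `*` A `<=` r].

Definition radius (E : binary_relational_system) (A : set E) : set (set (E * E)) :=
  [set r | relations E r /\ exists2 x, A x & A `<=` rball x r].

Definition equally_centered (E : binary_relational_system) (A : set E) :=
  radius A = diameter A.

Definition normal_structure (E : binary_relational_system) :=
  forall A : set E, ball_intersections E A ->
    ~ (exists x, A = [set x]) -> ~ equally_centered A.

Definition compact_structure (E : binary_relational_system) :=
  forall G : set (set E), G `<=` balls E ->
    (forall H, finite_set H -> H `<=` G -> \bigcap_(B in H) B !=set0) ->
    \bigcap_(B in G) B !=set0.

(* On the subtype [A], r `&` (A `*` A) becomes the pullback of r along [sval]. *)
Definition restriction (E : binary_relational_system) (A : set E) :=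
  @BinaryRelationalSystem (set_type A)
    [set [set p : A * A | r (sval p.1, sval p.2)] | r in relations E].

Definition retraction (E : binary_relational_system) (g : E -> E) :=
  endomorphism g /\ g \o g = g.

(* The restriction of E to A is a retract of E. *)
Definition is_retract (E : binary_relational_system) (A : set E) :=
  exists2 g : E -> E, retraction g & range g = A.

(* The restriction of E to A is a one-local retract of E; inside the subtype
   A `|` [set x], the set A is [set y | A (sval y)]. *)
Definition one_local_retract (E : binary_relational_system) (A : set E) :=
  forall x : E,
    @is_retract (restriction (A `|` [set x])) [set y | A (sval y)].

Definition common_fixed_points (E : binary_relational_system)
    (F : set (E -> E)) : set E :=
  [set x | forall f, F f -> f x = x].

(* Main.v *)
(** Call [D `<=` A] admissible in [A] when it is an intersection of balls with
    centers in [A], cut down to [A].  A Kirk-type argument shows that an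
    endomorphism preserving a set [A] with compact and normal structure fixes a
    point of [A], and one-local retracts and admissible subsets of [A] inherit
    both structures.  The key point (after Baillon) is that the intersection of
    a chain of one-local retracts [B] of [A] is nonempty: in a minimal
    decreasing family of nonempty sets [D_B] admissible in [B], every [D_B] is
    equally centered, hence a singleton, and all these singletons agree.
    Therefore there is a minimal one-local retract of [A] stable under [F]; it
    consists of common fixed points, since its intersection with the fixed
    points of any [f] in [F] is again a stable one-local retract.  Applied to
    the intersection of all balls centered at common fixed points and
    containing a given [x], this yields the retraction of [x]. *)
Require Import Defs.
From mathcomp Require Import all_boot boolp classical_sets cardinality.
Local Open Scope classical_set_scope.

(** * Minimal sets by Zorn's lemma, and finite families over a chain *)

Lemma exists_minimal_set (U : Type) (P : set (set U)) :
  P !=set0 ->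
  (forall C, C !=set0 -> C `<=` P -> total_on C subset ->
    P (\bigcap_(M in C) M)) ->
  exists2 M, P M & forall N, P N -> N `<=` M -> M `<=` N.
Proof.
move=> [M0 PM0] Pcap.
pose R (a b : {M | P M}) : bool := `[< sval b `<=` sval a >].
have [||| [M PM] Mmin] := @ZL_preorder _ (exist P M0 PM0) R.
- by move=> t; apply/asboolP.
- move=> r s t /asboolP sr /asboolP ts.
  by apply/asboolP; exact: subset_trans sr.
- move=> C Ctot; have [[c0 Cc0]|C0] := pselect (C !=set0); last first.
    by exists (exist P M0 PM0) => s Cs; case: C0; exists s.
  have PC : P (\bigcap_(M in [set sval c | c in C]) M).
    apply: Pcap.
    + by exists (sval c0); exists c0.
    + by move=> _ [[c Pc] _ <-].
    + move=> _ _ [c Cc <-] [d Cd <-].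
      by case: (Ctot _ _ Cc Cd) => /asboolP; [right|left].
  exists (exist P _ PC) => s Cs; apply/asboolP => /= x; apply.
  by exists s.
exists M => // N PN NM.
have /asboolP := Mmin (exist P N PN) (introT (asboolP _) NM).
by apply.
Qed.

Lemma finite_chain_lower_bound (U : Type) (C H : set (set U)) :
  C !=set0 -> total_on C subset -> finite_set H ->
  (forall B, H B -> exists2 D, C D & D `<=` B) ->
  exists2 D, C D & forall B, H B -> D `<=` B.
Proof.
move=> [D0 CD0] Ctot /(@finite_seqP {eclassic set U}) [s ->].
elim: s => [_|B s IHs HC]; first by exists D0.
have [|D CD Ds] := IHs.
  by move=> B' sB'; apply: HC; rewrite /= inE; apply/orP; right.
have [|D' CD' D'B] := HC B; first by rewrite /= inE eqxx.
have DB's (X : set U) : X `<=` D -> X `<=` D' ->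
    forall B', [set` B :: s] B' -> X `<=` B'.
  move=> XD XD' B'; rewrite /= inE => /orP[/eqP -> x /XD'/D'B //|sB' x /XD].
  exact: Ds.
by case: (Ctot _ _ CD CD') => DD'; [exists D|exists D'] => //; exact: DB's.
Qed.

(** * Admissible sets, traces and local retracts *)

Section RelativeStructure.
Context {E : binary_relational_system}.
Implicit Types (A B D M : set E) (r : set (E * E)).

(** The closure operator of admissibility: admissible sets are its closed sets, so families of balls
    need not be quantified over. *)
Definition cover A D : set E :=
  [set y | A y /\ forall c r, A c -> relations E r ->
     D `<=` rball c r -> r (c, y)].

Definition admissible A : set (set E) :=
  [set D | D `<=` A /\ cover A D `<=` D].

Lemma coverS A D D' : D `<=` D' -> cover A D `<=` cover A D'.
Proof.
move=> DD' y [Ay yD]; split=> // c r Ac Rr D'c.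
by apply: yD => //; exact: subset_trans D'c.
Qed.

Lemma sub_cover A D : D `<=` A -> D `<=` cover A D.
Proof. by move=> DA y Dy; split=> [|c r _ _]; [exact: DA|exact]. Qed.

Lemma admissible_self A : admissible A A.
Proof. by split=> // y []. Qed.

Lemma admissible_cover A D : D `<=` A -> admissible A (cover A D).
Proof.
move=> DA; split=> [y [] //|y [Ay yD]]; split=> // c r Ac Rr Dc.
by apply: yD => // z [_]; apply.
Qed.

Lemma admissible_bigcap A (C : set (set E)) :
  C !=set0 -> C `<=` admissible A -> admissible A (\bigcap_(D in C) D).
Proof.
move=> [D0 CD0] CA; split=> [x xC|x xC D CD].
  by have [DA _] := CA _ CD0; exact: DA (xC _ CD0).
by have [_] := CA _ CD; apply; apply: coverS xC => y; apply.
Qed.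

Lemma admissible_trans A D M : admissible A D -> admissible D M ->
  admissible A M.
Proof.
move=> [DA coverD] [MD coverM]; split=> [x /MD/DA //|y yM].
apply: coverM; split=> [|c r /DA Ac]; first exact/coverD/(coverS _ _ _ MD).
by case: yM => _; apply.
Qed.

(* Compactness is only ever used through chains of admissible sets. *)
Definition chain_compact A := forall C : set (set E),
  C !=set0 -> C `<=` admissible A -> (forall D, C D -> D !=set0) ->
  total_on C subset -> \bigcap_(D in C) D !=set0.

(** The inner hypothesis says that the radius lies in the diameter; the converse inclusion holds for
    nonempty [D]. Concluding with at most one point covers the empty set. *)
Definition relatively_normal A := forall D, admissible A D ->
  (forall r x, relations E r -> D x -> D `<=` rball x r ->
    forall u v, D u -> D v -> r (u, v)) ->
  forall u v, D u -> D v -> u = v.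

Definition compact_normal A := chain_compact A /\ relatively_normal A.

(* The one-local retracts of the restriction to [A]; [b] is the image of [x]
   under a retraction of [B `|` [set x]] onto [B]. *)
Definition local_retract A B := B `<=` A /\ forall x, A x ->
  exists2 b, B b & forall y r, B y -> relations E r -> r (y, x) -> r (y, b).

Lemma local_retract_refl A : local_retract A A.
Proof. by split=> // x Ax; exists x. Qed.

Lemma local_retract_trans A B D :
  local_retract A B -> local_retract B D -> local_retract A D.
Proof.
move=> [BA Bret] [DB Dret]; split=> [x /DB/BA //|x /Bret[b /Dret[d Dd dP] bP]].
by exists d => // y r Dy Rr yx; apply: dP => //; apply: bP => //; exact: DB.
Qed.

(** The points of [B] in this set are the possible values at [x] of a retraction onto [B]. *)
Definition trace A B x : set E :=
  [set y | A y /\ forall c r, B c -> relations E r -> r (c, x) -> r (c, y)].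

Lemma admissible_trace A B x : B `<=` A -> admissible A (trace A B x).
Proof.
move=> BA; split=> [y [] //|y [Ay yP]]; split=> // c r Bc Rr cx.
by apply: yP => // [|z [_]]; [exact: BA|apply].
Qed.

Lemma local_retract_trace A B :
  B `<=` A -> (forall x, A x -> B `&` trace A B x !=set0) -> local_retract A B.
Proof.
move=> BA Btr; split=> // x /Btr[b [Bb [_ bP]]].
by exists b => // y r By; exact: bP.
Qed.

Lemma trace_stable A B x (f : E -> E) : endomorphism f ->
  (forall y, A y -> A (f y)) -> (forall c, B c -> f c = c) ->
  forall y, trace A B x y -> trace A B x (f y).
Proof.
move=> fE fA fB y [Ay yP]; split=> [|c r Bc Rr cx]; first exact: fA.
by rewrite -(fB c Bc); apply: fE => //; exact: yP.
Qed.

Lemma compact_normal_admissible A D :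
  compact_normal A -> admissible A D -> compact_normal D.
Proof.
move=> [cA nA] DA; split=> [C C0 CD|M MD].
  by apply: cA => // M /CD; exact: admissible_trans.
by apply: nA; exact: admissible_trans MD.
Qed.

Lemma compact_normal_setT :
  compact_structure E -> normal_structure E -> compact_normal [set: E].
Proof.
move=> Ecomp Enorm; split=> [C C0 CT Cne Ctot|D [_ coverD] Deq u v Du Dv].
  (* A point common to all balls that contain some member of the chain lies in every member, as
     these are closed under [cover]. *)
  pose G := [set B | balls E B /\ exists2 D, C D & D `<=` B].
  have [|H finH HG|x xG] := Ecomp G; first by move=> B [].
    have [D CD DH] : exists2 D, C D & forall B, H B -> D `<=` B.
      by apply: finite_chain_lower_bound => // B /HG[].
    by have [x Dx] := Cne _ CD; exists x => B HB; exact: DH HB _ Dx.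
  exists x => D CD; have [_] := CT _ CD; apply; split=> // c r _ Rr Dc.
  by apply: (xG (rball c r)); split; [exists c, r|exists D].
apply: contrapT => uv.
have Dint : ball_intersections E D.
  exists [set B | balls E B /\ D `<=` B] => [B [] //|].
  apply/seteqP; split=> [x Dx B [_]|x xD]; first by apply.
  apply: coverD; split=> // c r _ Rr Dc.
  by apply: (xD (rball c r)); split=> //; exists c, r.
apply: (Enorm D Dint).
  by case=> x Dx; move: Du Dv uv; rewrite Dx => /= -> ->.
apply/seteqP; split=> [r [Rr [x Dx Dxr]]|r [Rr Dr]]; split=> //.
  by move=> [y z] [/= Dy Dz]; exact: Deq Dx Dxr _ _ Dy Dz.
by exists u => // y Dy; exact: Dr.
Qed.

(** * Inheritance of structure, fixed points and chains of local retracts *)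

Context (E_involutive : involutive_system E).

Lemma relation_sym r : relations E r ->
  exists2 s, relations E s & forall x y, s (x, y) <-> r (y, x).
Proof. by move=> /E_involutive Rr; exists (r^-1)%relation. Qed.

(* A set D admissible in B has the same diameter and radius as [cover A D]. *)
Lemma compact_normal_local_retract A B :
  compact_normal A -> local_retract A B -> compact_normal B.
Proof.
move=> [cA nA] [BA Bret].
split=> [C C0 CB Cne Ctot|D [DB coverD] Deq u v Du Dv].
  have [||||x xC] := cA [set cover A D | D in C].
  - by have [D CD] := C0; exists (cover A D); exists D.
  - move=> _ [D /CB[DB _] <-]; apply: admissible_cover.
    exact: subset_trans BA.
  - move=> _ [D CD <-]; have [x Dx] := Cne _ CD; exists x.
    by apply: sub_cover => // y /(proj1 (CB _ CD))/BA.
  - move=> _ _ [D CD <-] [D' CD' <-].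
    by case: (Ctot _ _ CD CD') => ?; [left|right]; exact: coverS.
  have xcov D : C D -> cover A D x by move=> CD; apply: xC; exists D.
  have [D0 CD0] := C0.
  have [b Bb bP] := Bret x (proj1 (xcov _ CD0)).
  exists b => D CD; have [_] := CB _ CD; apply; split=> // c r Bc Rr Dc.
  by apply: bP => //; apply: (proj2 (xcov _ CD)) => //; exact: BA.
have DA : D `<=` A by exact: subset_trans BA.
have Dcov := sub_cover _ _ DA.
apply: (nA _ (admissible_cover _ _ DA)); [|exact: Dcov|exact: Dcov].
move=> r z Rr [Az zD] zr.
have [s Rs sP] := relation_sym _ Rr.
(* The [r]-center [z] of the cover is sent to an [r]-center [b] of [D]; [b] is in [D] because every
   ball centered in [B] and containing [D] contains [z]. *)
have Dr : forall x y, D x -> D y -> r (x, y).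
  have [b Bb bP] := Bret z Az.
  apply: (Deq r b) => // [|d Dd].
    apply: coverD; split=> // c t Bc Rt Dc.
    by apply: bP => //; apply: zD => //; exact: BA.
  apply/sP; apply: bP => //; first exact: DB.
  by apply/sP; apply: zr; exact: Dcov.
move=> x y [Ax xD] [Ay yD]; apply: yD => // d Dd.
apply/sP; apply: xD => // [|e De]; first exact: DA.
by apply/sP; exact: Dr.
Qed.

(** In a minimal nonempty stable admissible [M], the [r]-centers of [M] form a stable admissible
    set, hence all of [M]. Normality then makes [M] a single point. *)
Lemma fixed_point A (f : E -> E) : compact_normal A -> A !=set0 ->
  endomorphism f -> (forall x, A x -> A (f x)) -> exists2 x, A x & f x = x.
Proof.
move=> [cA nA] A0 fE fA.
pose P := [set M | [/\ admissible A M, M !=set0 & forall x, M x -> M (f x)]].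
have [||M [MA M0 fM] Mmin] := exists_minimal_set _ P.
- by exists A; split=> //; exact: admissible_self.
- move=> C C0 CP Ctot; split=> [||x xC D CD].
  + by apply: admissible_bigcap => // D /CP[].
  + by apply: cA => // D /CP[].
  + by have [_ _] := CP _ CD; apply; exact: xC.
have fMA : f @` M `<=` A by move=> _ [x Mx <-]; apply/fA/(proj1 MA).
have MfM : M `<=` cover A (f @` M).
  (* Being inside [M], this cover is stable under [f], so minimality applies to it. *)
  have sub : cover A (f @` M) `<=` M.
    apply: subset_trans (proj2 MA); apply: coverS => _ [x Mx <-].
    exact: fM.
  apply: Mmin => //; split=> [||x /sub Mx]; first exact: admissible_cover.
    by have [x Mx] := M0; exists (f x); apply: sub_cover => //; exists x.
  by apply: sub_cover => //; exists x.
have Meq u v : M u -> M v -> u = v.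
  apply: (nA _ MA) => r x Rr Mx Mxr y z My Mz.
  have [s Rs sP] := relation_sym _ Rr.
  pose N := [set w | M w /\ M `<=` rball w r].
  have NM : N `<=` M by move=> w [].
  suff PN : P N by have [_] := Mmin N PN NM _ My; apply.
  split=> [||w [Mw Mwr]].
  (* By symmetry, [N] is cut out of [M] by balls of the inverse radius centered in [M]. *)
  - split=> [w /NM/(proj1 MA)//|w wN]; split=> [|d Md].
      exact/(proj2 MA)/(coverS _ _ _ NM).
    apply/sP; apply: (proj2 wN) => // [|e [_ er]]; first exact: (proj1 MA).
    by apply/sP; exact: er.
  - by exists x.
  (* The ball around [f w] contains the image of [M], hence its cover, hence [M]. *)
  - split=> [|d /MfM[_]]; first exact: fM.
    apply=> //; first exact/fA/(proj1 MA).
    by move=> _ [e Me <-]; apply: fE => //; exact: Mwr.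
have [x Mx] := M0; exists x; first exact: (proj1 MA).
by apply: Meq => //; exact: fM.
Qed.

(* A family of sets indexed by the members of a chain is encoded as the set of
   pairs (index, point). *)
Lemma chain_local_retract_nonempty A (C : set (set E)) :
  compact_normal A -> A !=set0 -> C !=set0 -> total_on C subset ->
  (forall B, C B -> local_retract A B) -> \bigcap_(B in C) B !=set0.
Proof.
move=> gA [a0 Aa0] [B0 CB0] Ctot Cret.
have gC B : C B -> compact_normal B.
  by move=> CB; apply: compact_normal_local_retract gA _; exact: Cret.
pose fib (M : set (set E * E)) B := [set x | M (B, x)].
pose P := [set M : set (set E * E) | [/\ forall B x, M (B, x) -> C B,
   forall B, C B -> admissible B (fib M B) /\ fib M B !=set0 &
   forall B B', C B -> C B' -> B `<=` B' -> fib M B `<=` fib M B']].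
have [||M [MC MB Mmono] Mmin] := exists_minimal_set _ P.
- exists [set p | C p.1 /\ p.1 p.2]; split=> [B x []//|B CB|B B' CB CB' BB' x].
    have fibB : fib [set p | C p.1 /\ p.1 p.2] B = B.
      by apply/seteqP; split=> [x []|x Bx] //; split.
    rewrite fibB; split; first exact: admissible_self.
    by have [b Bb _] := proj2 (Cret _ CB) _ Aa0; exists b.
  by move=> [_ /= Bx]; split=> //; exact: BB'.
- move=> K [M0 KM0] KP Ktot.
  have fibK B : fib (\bigcap_(M in K) M) B =
      \bigcap_(D in [set fib M B | M in K]) D.
    apply/seteqP; split=> [x xK _ [M KM <-]|x xK M KM]; first exact: xK.
    by apply: (xK (fib M B)); exists M.
  split=> [B x MBx|B CB|B B' CB CB' BB' x Kx M KM].
  + by have [MC _ _] := KP _ KM0; exact: MC (MBx _ KM0).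
  + have fibs_ne : [set fib M B | M in K] !=set0.
      by exists (fib M0 B); exists M0.
    have fibs_adm : [set fib M B | M in K] `<=` admissible B.
      by move=> _ [M /KP[_ MB _] <-]; have [] := MB _ CB.
    rewrite fibK; split; first exact: admissible_bigcap.
    apply: (proj1 (gC _ CB)) => //.
      by move=> _ [M /KP[_ MB _] <-]; have [] := MB _ CB.
    move=> _ _ [M KM <-] [N KN <-].
    by case: (Ktot _ _ KM KN) => MN; [left|right] => x; exact: MN.
  + by have [_ _ Mmono] := KP _ KM; apply: Mmono BB' _ (Kx _ KM).
have MsubB B : C B -> fib M B `<=` B by move=> CB; have [[]] := MB _ CB.
(* Otherwise intersecting all fibers with the ball contradicts minimality. *)
have ball_all B c r : C B -> B c -> relations E r -> fib M B `<=` rball c r ->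
    forall B', C B' -> fib M B' `<=` rball c r.
  move=> CB Bc Rr Bcr.
  pose N := [set p | M p /\ r (c, p.2)].
  suff PN : P N.
    by move=> B' CB' x Mx; have [|//] := Mmin N PN _ _ Mx; move=> p [].
  have NM B' : fib N B' `<=` fib M B' by move=> x [].
  split=> [B' x [/MC]//|B' CB'|B1 B2 CB1 CB2 B12 x [Mx cx]]; last first.
    by split=> //; exact: Mmono Mx.
  have [MB'adm [x Mx]] := MB _ CB'.
  have [B'B|BB'] := Ctot _ _ CB' CB.
    have -> : fib N B' = fib M B'; last by split=> //; exists x.
    apply/seteqP; split=> // y My; split=> //.
    by apply: Bcr; exact: Mmono My.
  split.
    split=> [y /NM/(MsubB _ CB')//|y yN]; split.
      exact/(proj2 MB'adm)/(coverS _ _ _ (NM _)).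
    by apply: (proj2 yN) => // [|z []//]; exact: BB'.
  have [_ [y My]] := MB _ CB; exists y; split; first exact: Mmono My.
  exact: Bcr.
have fib_eq B : C B -> forall u v, fib M B u -> fib M B v -> u = v.
  move=> CB; apply: (proj2 (gC _ CB)) => [|r x Rr Mx Mxr u v Mu Mv].
    by have [] := MB _ CB.
  have [s Rs sP] := relation_sym _ Rr.
  (* At index [p.1] keep the points whose [r]-ball contains every fiber with index inside both [B]
     and [p.1]. By minimality nothing is lost, and index [B] gives the diameter bound. *)
  pose N := [set p | M p /\ forall L, C L -> L `<=` B -> L `<=` p.1 ->
                        fib M L `<=` rball p.2 r].
  suff PN : P N.
    have [|_ /(_ B)] := Mmin N PN _ (B, u) Mu; first by move=> p [].
    by apply.
  have NM L : fib N L `<=` fib M L by move=> y [].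
  split=> [L y [/MC]//|L CL|L L' CL CL' LL' y [My yP]].
  - split.
      split=> [y /NM/(MsubB _ CL)//|y yN]; split.
        by apply/(proj2 (proj1 (MB _ CL)))/(coverS _ _ _ (NM _)).
      move=> K CK KB KL z Mz; apply/sP; apply: (proj2 yN) => //.
        exact/KL/(MsubB _ CK).
      by move=> w [_ wP]; apply/sP; exact: wP Mz.
    (* Nonemptiness: above [B] the center [x] itself works; below [B] its image [b] in [L] does, and
       [ball_all] places [b] in the fiber. *)
    have [BL|LB] := Ctot _ _ CB CL.
      exists x; split; first exact: Mmono Mx.
      by move=> K CK KB _ z /(Mmono _ _ CK CB KB); exact: Mxr.
    have [BA _] := Cret _ CB; have [_ Lret] := Cret _ CL.
    have [b Lb bP] := Lret x (BA _ (MsubB _ CB _ Mx)).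
    exists b; split=> [|K CK KB KL z Mz].
      apply: (proj2 (proj1 (MB _ CL))); split=> // c t Lc Rt Lct.
      by apply: bP => //; exact: (ball_all L) CB _ Mx.
    apply/sP; apply: bP => //; first exact/KL/(MsubB _ CK).
    by apply/sP/Mxr; exact: Mmono Mz.
  - split; first exact: Mmono My.
    move=> K CK KB KL'; have [LB|BL] := Ctot _ _ CL CB.
      by apply: (ball_all L) => //; [exact: (MsubB _ CL)|exact: yP].
    by move=> z /(Mmono _ _ CK CB KB); exact: yP.
have [_ [x Mx]] := MB _ CB0.
exists x => B CB; have [B0B|BB0] := Ctot _ _ CB0 CB.
  by apply: (MsubB _ CB); exact: Mmono Mx.
have [_ [y My]] := MB _ CB.
rewrite (fib_eq _ CB0 x y) //; first exact: MsubB My.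
exact: Mmono My.
Qed.

(** Nonemptiness is applied inside the trace at [x]. Each [B] meets the trace in a local retract of
    it, since the balls defining the trace have centers in [B] and so keep the image of any of its
    points. *)
Lemma chain_local_retract A (C : set (set E)) :
  compact_normal A -> C !=set0 -> total_on C subset ->
  (forall B, C B -> local_retract A B) -> local_retract A (\bigcap_(B in C) B).
Proof.
move=> gA [B0 CB0] Ctot Cret; set I := \bigcap_(B in C) B.
have IA : I `<=` A by move=> x xC; exact: (proj1 (Cret _ CB0)) (xC _ CB0).
apply: local_retract_trace => // x Ax.
have [|||||y yC] := @chain_local_retract_nonempty (trace A I x)
    [set B `&` trace A I x | B in C].
- exact: compact_normal_admissible gA (admissible_trace _ _ _ IA).
- by exists x.
- by exists (B0 `&` trace A I x); exists B0.
- move=> _ _ [B CB <-] [B' CB' <-].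
  by case: (Ctot _ _ CB CB') => ?; [left|right]; exact: setSI.
- move=> _ [B CB <-]; split=> [y []//|z [Az zP]].
  have [b Bb bP] := proj2 (Cret _ CB) z Az.
  have [BA _] := Cret _ CB.
  exists b => [|y r [By _]]; last exact: bP.
  split=> //; split=> [|c r Ic Rr cx]; first exact: BA.
  by apply: bP => //; [exact: Ic|exact: zP].
exists y; split=> [B CB|]; first by have [] := yC _ (imageP _ CB).
by have [] := yC _ (imageP _ CB0).
Qed.

(** The balls defining the trace at [x] have fixed centers, so [f] preserves the trace and has a
    fixed point there. *)
Lemma local_retract_fixed A (f : E -> E) : compact_normal A ->
  endomorphism f -> (forall x, A x -> A (f x)) ->
  local_retract A [set x | A x /\ f x = x].
Proof.
move=> gA fE fA; have FA : [set x | A x /\ f x = x] `<=` A by move=> x [].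
apply: local_retract_trace => // x Ax.
have [|||y ytr fy] := fixed_point (trace A [set x | A x /\ f x = x] x) f _ _ fE.
- exact: compact_normal_admissible gA (admissible_trace _ _ _ FA).
- by exists x.
- by apply: trace_stable => // c [].
by exists y; split=> //; split=> //; case: ytr.
Qed.

(** * Common fixed points and the passage to actual retractions *)

Lemma common_fixed_point A (F : set (E -> E)) : compact_normal A -> A !=set0 ->
  (forall f, F f -> endomorphism f) ->
  (forall f g, F f -> F g -> f \o g = g \o f) ->
  (forall f, F f -> forall x, A x -> A (f x)) ->
  exists2 x, A x & common_fixed_points F x.
Proof.
move=> gA [a Aa] FE Fcomm FA.
pose P := [set B | local_retract A B /\
  forall f, F f -> forall x, B x -> B (f x)].
have [||M [Mret FM] Mmin] := exists_minimal_set _ P.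
- by exists A; split=> //; exact: local_retract_refl.
- move=> C C0 CP Ctot; split=> [|f Ff x xC B CB].
    by apply: chain_local_retract => // B /CP[].
  by have [_] := CP _ CB; apply=> //; exact: xC.
have [x Mx _] := proj2 Mret _ Aa.
exists x; first exact: (proj1 Mret).
move=> f Ff.
(* Commutation makes the fixed points of [f] in [M] stable under [F], so minimality forces [f] to
   fix all of [M]. *)
have [|y []//|//] := Mmin [set y | M y /\ f y = y] _ _ x Mx.
split=> [|g Fg y [My fy]].
  apply: (local_retract_trans _ _ _ Mret); apply: local_retract_fixed.
  - exact: compact_normal_local_retract Mret.
  - exact: FE.
  - exact: FM.
split; first exact: FM.
by have /= -> := congr1 (@^~ y) (Fcomm f g Ff Fg); rewrite fy.
Qed.

(** The retraction fixes [B] and sends [x] outside [B] to [b]. Involutivity handles pairs with [x]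
    in first position, and reflexivity the pair [(x, x)]. *)
Lemma one_local_retract_local_retract B : reflexive_system E ->
  local_retract [set: E] B -> one_local_retract B.
Proof.
move=> Erefl [_ Bret] x; have [b Bb bP] := Bret x I.
have Bx y : B y -> y \in B `|` [set x] by move=> By; rewrite inE; left.
pose g (y : set_type (B `|` [set x])) : set_type (B `|` [set x]) :=
  if pselect (B (sval y)) then y else exist _ b (Bx b Bb).
have gB y : B (sval y) -> g y = y by rewrite /g; case: pselect.
have Bg y : B (sval (g y)) by rewrite /g; case: pselect.
have gx y : ~ B (sval y) -> sval y = x /\ sval (g y) = b.
  move=> NBy; split; last by rewrite /g; case: pselect.
  by have := svalP y; rewrite inE => -[].
exists g; last first.
  apply/seteqP; split=> [_ [y _ <-]|y By]; first exact: Bg.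
  by exists y => //; exact: gB.
split; last by apply/funext => y /=; exact/gB/Bg.
move=> _ [r Rr <-] y z /= yz.
have [s Rs sP] := relation_sym _ Rr.
have [By|/gx[yx gyb]] := pselect (B (sval y));
  have [Bz|/gx[zx gzb]] := pselect (B (sval z)).
- by rewrite !gB.
- by rewrite (gB y) // gzb; apply: bP => //; move: yz; rewrite zx.
- rewrite (gB z) // gyb; apply/sP; apply: bP => //.
  by apply/sP; move: yz; rewrite yx.
- by rewrite gyb gzb; exact: Erefl.
Qed.

End RelativeStructure.

Theorem theorem3p6 (E : binary_relational_system)
  (E_nonempty : [set: E] !=set0)
  (E_involutive : involutive_system E)
  (E_reflexive : reflexive_system E)
  (E_compact : compact_structure E)
  (E_normal : normal_structure E)
  (F : set (E -> E))
  (F_endo : forall f, F f -> endomorphism f)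
  (F_commute : forall f g, F f -> F g -> f \o g = g \o f) :
  common_fixed_points F !=set0 /\
  one_local_retract (common_fixed_points F).
Proof.
have gT := compact_normal_setT E_compact E_normal.
split.
  have [//|x _ Fx] := common_fixed_point E_involutive _ F gT
    E_nonempty F_endo F_commute.
  by exists x.
apply: one_local_retract_local_retract => //.
apply: local_retract_trace => // x _.
have [|||y ytr Fy] := common_fixed_point E_involutive
    (trace [set: E] (common_fixed_points F) x) F _ _ F_endo F_commute.
- exact: compact_normal_admissible gT (admissible_trace _ _ _ _).
- by exists x.
- by move=> f Ff; apply: trace_stable => //; [exact: F_endo|move=> c; exact].
by exists y.
Qed.
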